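(* There is no body $B \subset \mathbb{R}^2$ that is invisible in infinitely many directions; that is, for every body $B \subset \mathbb{R}^2$, the set of vectors $v \in S^1$ such that $B$ is invisible in the direction $v$ is finite.
   Context: Piecewise smooth sets. A set $\gamma \subset \mathbb{R}^2$ is a piecewise smooth 1D set if it is the union of a finite number of curves, $\gamma = \bigcup_{i=1}^m \gamma_i([a_i,b_i])$ ($m \ge 1$, $a_i<b_i$), where: each $\gamma_i : [a_i,b_i] \to \mathbb{R}^2$ is of class $C^1$ (with one-sided derivatives at $a_i$ and $b_i$); $|\gamma_i'(t)| \neq 0$ for all $t \in [a_i,b_i]$; $\gamma_i(t_1)=\gamma_i(t_2)$ with $t_1,t_2 \in (a_i,b_i)$ implies $t_1=t_2$; and $\gamma_i((a_i,b_i)) \cap \gamma_j((a_j,b_j)) = \emptyset$ for $i \ne j$. The endpoints $\gamma_i(a_i), \gamma_i(b_i)$, $i=1,\dots,m$, are called singular points of $\gamma$; all other points of $\gamma$ are called regular. Bodies. A body is a compact set $B \subset \mathbb{R}^2$ (not necessarily connected) whose boundary $\partial B$ is a piecewise smooth 1D set. Writing $\partial B = \bigcup_{i=1}^m \gamma_i([a_i,b_i])$ with curves $\gamma_i$ having the properties required of a piecewise smooth 1D set, the singular points of $\partial B$ are the endpoints $\gamma_i(a_i), \gamma_i(b_i)$, $i=1,\dots,m$, and all other points of $\partial B$ are its regular points. At a regular point $\xi\in\partial B$, $n(\xi)$ denotes the outer unit normal to $B$. Billiard. We consider the billiard in $\mathbb{R}^2 \setminus B$: a particle moves with unit speed, freely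 along straight lines outside $B$, and is reflected elastically at regular points $\xi$ of $\partial B$, its velocity $w$ being replaced by $w - 2\langle w, n(\xi)\rangle n(\xi)$. A billiard motion $x(t), x'(t)$ is regular if it is defined for all $t \in \mathbb{R}$ and has a finite number (possibly zero) of reflections, at regular points of $\partial B$. For a regular motion, $x(t) = x + vt$ for $t \le t_i$ and $x(t) = x^+ + v^+ t$ for $t \ge t_f$, where $t_i$, $t_f$ are the instants of the first and the final reflection (with no reflections, $x(t)=x+vt$ for all $t$). The pair $x \in \mathbb{R}^2$, $v \in S^1$ is the initial data and $x^+ = x^+(x,v)$, $v^+ = v^+(x,v)$ the final data of the motion. The initial data $x,v$ make sense for any $x \in \mathbb{R}^2$, even $x \in B$: the particle comes from infinity along the line $\{x+vt\}$ with velocity $v$ until its first collision with $B$; changing $x$ by a multiple of $v$ only shifts time. Invisibility. A regular motion is unperturbed by $B$ if its initial data $x,v$ and final data $x^+,v^+$ satisfy $v^+ = v$ and $x^+ - x$ is parallel to $v$ (the case $x^+=x$ included). For $v \in S^1$, the body $B$ is invisible in the direction $v$ if for (Lebesgue-)almost all $x \in \mathbb{R}^2$ the billiard motion with initial data $x, v$ is regular and unperturbed by $B$. *)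

(* Defs.v *)
From mathcomp Require Import all_boot all_order all_algebra.
From mathcomp Require Import all_classical all_reals all_analysis.

Set Implicit Arguments.
Unset Strict Implicit.
Unset Printing Implicit Defensive.

Import Order.TTheory GRing.Theory Num.Theory.
Import numFieldNormedType.Exports.

Local Open Scope classical_set_scope.
Local Open Scope ring_scope.

(* The library norm of R * R is the sup norm; the Euclidean structure that
   unit vectors and reflections refer to is given by [dot]. *)
Definition dot (R : realType) (u v : R * R) : R := u.1 * v.1 + u.2 * v.2.

Definition unit_circle (R : realType) : set (R * R) := [set v | dot v v = 1].
Arguments unit_circle R : clear implicits.

Definition boundary (T : topologicalType) (A : set T) : set T :=
  closure A `\` interior A.

(* [arc_fun] and [arc_der] only matter on [arc_lo, arc_hi]. The limit in
   [arc_derE] is restricted to that interval, so it is the two-sided derivative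
   inside and the one-sided derivative at the endpoints. *)
Record arc (R : realType) := Arc {
  arc_lo : R;
  arc_hi : R;
  arc_fun : R -> R * R;
  arc_der : R -> R * R;
  arc_lt : arc_lo < arc_hi;
  arc_derE : forall t, t \in `[arc_lo, arc_hi] ->
    (s - t)^-1 *: (arc_fun s - arc_fun t)
      @[s --> within `[arc_lo, arc_hi] t^'] --> arc_der t;
  arc_der_continuous : {within `[arc_lo, arc_hi], continuous arc_der};
  arc_der_neq0 : forall t, t \in `[arc_lo, arc_hi] -> arc_der t != 0;
  arc_inj : forall t1 t2, t1 \in `]arc_lo, arc_hi[ -> t2 \in `]arc_lo, arc_hi[ ->
    arc_fun t1 = arc_fun t2 -> t1 = t2 }.

Definition arc_image (R : realType) (c : arc R) : set (R * R) :=
  arc_fun c @` `[arc_lo c, arc_hi c].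

Definition arc_inner (R : realType) (c : arc R) : set (R * R) :=
  arc_fun c @` `]arc_lo c, arc_hi c[.

Definition arc_ends (R : realType) (c : arc R) : set (R * R) :=
  [set arc_fun c (arc_lo c); arc_fun c (arc_hi c)].

(* Singular and regular points depend on how a set is cut into arcs, so the
   decomposition is kept as data. *)
Record piecewise_smooth (R : realType) (S : set (R * R)) := PiecewiseSmooth {
  ps_size : nat;
  ps_arc : 'I_ps_size -> arc R;
  ps_size_gt0 : (0 < ps_size)%N;
  ps_disjoint : forall i j, i != j ->
    arc_inner (ps_arc i) `&` arc_inner (ps_arc j) = set0;
  ps_cover : S = \bigcup_i arc_image (ps_arc i) }.
Arguments ps_size {R S} p.
Arguments ps_arc {R S} p i.

Definition singular_points (R : realType) (S : set (R * R))
    (P : piecewise_smooth S) : set (R * R) :=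
  \bigcup_i arc_ends (ps_arc P i).

Definition regular_points (R : realType) (S : set (R * R))
    (P : piecewise_smooth S) : set (R * R) :=
  S `\` singular_points P.

Record body (R : realType) := Body {
  body_set : set (R * R);
  body_compact : compact body_set;
  body_boundary : piecewise_smooth (boundary body_set) }.

(* If [B] lies on neither side of the boundary near [xi] (it is locally just
   the curve), both unit normals qualify; the reflection law does not
   distinguish [n] from [- n]. *)
Definition outer_normal (R : realType) (B : body R) (xi n : R * R) : Prop :=
  [/\ unit_circle R n,
      exists i t, let c := ps_arc (body_boundary B) i in
        [/\ t \in `]arc_lo c, arc_hi c[, arc_fun c t = xi
          & dot n (arc_der c t) = 0]
    & \forall s \near 0^'+, ~ body_set B (xi + s *: n)].

Definition reflect (R : realType) (n w : R * R) : R * R :=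
  w - (2 * dot w n) *: n.

(* The reflection instants of a motion are exactly the times at which it is on
   [B]; a tangential contact is a reflection that leaves the velocity as is. *)
Definition reflection_instants (R : realType) (B : body R) (y : R -> R * R) :
    set R :=
  [set t | body_set B (y t)].

Definition billiard_motion (R : realType) (B : body R) (y : R -> R * R) : Prop :=
  (forall t, ~ reflection_instants B y t ->
     exists w, unit_circle R w /\
       \forall s \near t, y s = y t + (s - t) *: w) /\
  (forall t, reflection_instants B y t ->
     regular_points (body_boundary B) (y t) /\
     exists w n, [/\ unit_circle R w, outer_normal B (y t) n,
       \forall s \near t, s <= t -> y s = y t + (s - t) *: w
     & \forall s \near t, t <= s -> y s = y t + (s - t) *: reflect n w]).

Definition regular_motion (R : realType) (B : body R) (y : R -> R * R) : Prop :=
  billiard_motion B y /\ finite_set (reflection_instants B y).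

Definition initial_data (R : realType) (B : body R) (y : R -> R * R)
    (x v : R * R) : Prop :=
  unit_circle R v /\
  forall t, (forall s, reflection_instants B y s -> t <= s) -> y t = x + t *: v.

Definition final_data (R : realType) (B : body R) (y : R -> R * R)
    (x v : R * R) : Prop :=
  unit_circle R v /\
  forall t, (forall s, reflection_instants B y s -> s <= t) -> y t = x + t *: v.

Definition unperturbed (R : realType) (x v x' v' : R * R) : Prop :=
  v' = v /\ exists c : R, x' - x = c *: v.

(* The motion with given initial data is unique when it exists, so "the motion
   is regular and unperturbed" is rendered as an existential. *)
Definition invisible (R : realType) (B : body R) (v : R * R) : Prop :=
  {ae (@lebesgue_measure R \x @lebesgue_measure R)%E, forall x : R * R,
    exists (y : R -> R * R) (x' v' : R * R),
      [/\ regular_motion B y, initial_data B y x v, final_data B y x' v'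
        & unperturbed x v x' v']}.

(* Main.v *)
Require Import Defs.
From mathcomp Require Import all_boot all_order all_algebra.
From mathcomp Require Import all_classical all_reals all_analysis.
From mathcomp Require Import ring lra.

Set Implicit Arguments.
Unset Strict Implicit.
Unset Printing Implicit Defensive.

Import Order.TTheory GRing.Theory Num.Theory.
Import numFieldNormedType.Exports.

Local Open Scope classical_set_scope.
Local Open Scope ring_scope.

(** A direction of invisibility is tied to the finitely many ends of the arcs
    that make up the boundary: it is perpendicular to the tangent of an arc at
    one of its ends, or parallel to the line through two distinct ends
    ([invisible_exceptional]). Each such condition leaves two unit vectors.

    To see this, let [v] be a direction of invisibility, draw the supporting
    line of the body parallel to [v], on one fixed side, and let [p] be the
    first point of the body on this line in the direction [v]. If some arc
    leaves [p] in a direction [d] with [dot d v < 0], the body is not invisible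
    along [v]. The motion that shows it is found by Fermat's principle. Put a
    point [f] just above and behind [p], and let [z] minimise over the body the
    length of the path that comes from infinity along [v] to [z] and goes
    straight on to [f]. In other words, a parabola of axis [v] and focus [f]
    touches the body at [z] from outside ([parabola_contact]). If [z] is
    regular, the particle that follows this path is reflected at [z] towards
    [f], meets the body neither before nor after, and escapes above the
    supporting line ([parabola_visible]). The backward arc makes some path
    shorter than the one through [p], so [z] is not [p]; and [z] is close to the
    part of the supporting line behind [p], so it is not one of the other
    singular points either ([germ_forward]). Finally, a single motion with one
    transversal reflection perturbs an open set of initial data
    ([single_reflection]), which is not negligible.

    So all arcs at [p] leave it without going backwards. An arc that passed
    through [p] would leave it in two opposite directions, hence perpendicularly
    to [v], and downwards both ways; so [p] is an end of its arcs
    ([first_touch_end]). Up to the directions perpendicular to an end tangent,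
    the arcs leave [p] strictly forwards. Reversing time, the body is invisible
    along [- v] too ([invisible_opp]), and the last point of the body on the
    supporting line is an end that all its arcs leave strictly backwards. It
    is therefore distinct from [p]. *)

Section Invisibility.
Context {R : realType}.
Implicit Types (u v w m n d p q : R * R) (a b s t : R) (B : body R).

(** * Plane vectors and mirrors *)

Definition perp u : R * R := (- u.2, u.1).

Lemma pair_addE u v : u + v = (u.1 + v.1, u.2 + v.2).
Proof. by []. Qed.
Lemma pair_oppE u : - u = (- u.1, - u.2).
Proof. by []. Qed.
Lemma pair_scaleE a u : a *: u = (a * u.1, a * u.2).
Proof. by []. Qed.
Definition pairE := (pair_addE, pair_oppE, pair_scaleE).

Lemma pair_ext u v : u.1 = v.1 -> u.2 = v.2 -> u = v.
Proof. by case: u v => [? ?] [? ?] /= -> ->. Qed.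

Lemma dotC u v : dot u v = dot v u.
Proof. by rewrite /dot; ring. Qed.
Lemma dotDl u v w : dot (u + v) w = dot u w + dot v w.
Proof. by rewrite /dot !pairE /=; ring. Qed.
Lemma dotNl u w : dot (- u) w = - dot u w.
Proof. by rewrite /dot !pairE /=; ring. Qed.
Lemma dotBl u v w : dot (u - v) w = dot u w - dot v w.
Proof. by rewrite dotDl dotNl. Qed.
Lemma dotZl a u w : dot (a *: u) w = a * dot u w.
Proof. by rewrite /dot !pairE /=; ring. Qed.
Lemma dotDr u v w : dot w (u + v) = dot w u + dot w v.
Proof. by rewrite /dot !pairE /=; ring. Qed.
Lemma dotNr u w : dot w (- u) = - dot w u.
Proof. by rewrite /dot !pairE /=; ring. Qed.
Lemma dotZr a u w : dot w (a *: u) = a * dot w u.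
Proof. by rewrite /dot !pairE /=; ring. Qed.
Definition dotE := (dotDl, dotNl, dotZl, dotDr, dotNr, dotZr).

Lemma dot_perp u : dot u (perp u) = 0.
Proof. by rewrite /dot /=; ring. Qed.
Lemma dot_perpl u v : dot (perp u) v = - dot u (perp v).
Proof. by rewrite /dot /=; ring. Qed.

Lemma dot_perp_perp d : dot (perp d) (perp d) = dot d d.
Proof. by rewrite /dot /=; ring. Qed.

Lemma dot_gt0 u : (0 < dot u u) = (u != 0).
Proof.
apply/idP/idP => [|u0]; first by apply: contraTneq => ->; rewrite /dot/= mulr0 addr0 ltxx.
rewrite lt_neqAle eq_sym; apply/andP; split; last by rewrite /dot; nra.
apply: contra u0 => /eqP; rewrite /dot => e.
by apply/eqP/pair_ext => /=; nra.
Qed.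

Lemma unit_neq0 v : unit_circle R v -> v != 0.
Proof. by move=> e; rewrite -dot_gt0 e ltr01. Qed.

Lemma unit_opp v : unit_circle R v -> unit_circle R (- v).
Proof. by rewrite /unit_circle/= !dotE opprK. Qed.

(** The normal is free up to sign, so that [v] and [- v] can be studied with
    the same [m], on the same side of a body. *)
Definition frame v m := unit_circle R v /\ (m = perp v \/ m = - perp v).

Lemma frame_perp v : unit_circle R v -> frame v (perp v).
Proof. by split=> //; left. Qed.

Lemma frame_opp v m : frame v m -> frame (- v) m.
Proof.
move=> [v1 mv]; split; first exact: unit_opp.
have e : perp (- v) = - perp v by [].
by case: mv => ->; [right|left]; rewrite e ?opprK.
Qed.

Lemma frame_unit v m : frame v m -> dot m m = 1.
Proof. by move=> [v1 [|]] ->; rewrite ?dotNr ?dotNl ?opprK dot_perp_perp. Qed.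

Lemma frame_orth v m : frame v m -> dot v m = 0.
Proof. by move=> [_ [|]] ->; rewrite ?dotNr dot_perp ?oppr0. Qed.

Lemma dot_frame v m : frame v m ->
  forall p q, dot p q = dot p v * dot q v + dot p m * dot q m.
Proof.
move=> [e h] p q; rewrite -[LHS]mulr1 -e.
by case: h => ->; rewrite /dot ?pairE /=; ring.
Qed.

Lemma frame_eq0 v m p : frame v m -> dot p v = 0 -> dot p m = 0 -> p = 0.
Proof.
move=> vm pv pm; apply/eqP; apply: contraT; rewrite -dot_gt0.
by rewrite (dot_frame vm) pv pm mulr0 addr0 ltxx.
Qed.

(** Reflection at a point with tangent [d]: unlike [Defs.reflect] it is fed the
    tangent, which varies continuously along an arc, instead of a unit normal,
    which is only determined up to sign. *)
Definition mirror d v : R * R :=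
  v - (2 * dot v (perp d) / dot d d) *: perp d.

Lemma perp_colinear d n : d != 0 -> dot n d = 0 -> exists k, n = k *: perp d.
Proof.
rewrite -dot_gt0 => d0 nd; exists (dot n (perp d) / dot d d).
suff e : dot d d *: n = dot n (perp d) *: perp d.
  by rewrite mulrC -scalerA -e scalerA mulVf ?scale1r ?gt_eqF.
move: nd; rewrite /dot => nd; apply: pair_ext; rewrite !pairE /=.
  by have := congr1 (fun z => d.1 * z) nd; lra.
by have := congr1 (fun z => d.2 * z) nd; lra.
Qed.

Lemma mirrorE d n v : d != 0 -> n != 0 -> dot n d = 0 ->
  mirror d v = v - (2 * dot v n / dot n n) *: n.
Proof.
move=> d0 n0 nd; congr (_ - _).
have [k nE] := perp_colinear d0 nd.
have k0 : k != 0.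
  by apply: contraNneq n0 => k0; rewrite nE k0 scale0r.
have d0' : dot d d != 0 by rewrite gt_eqF ?dot_gt0.
rewrite nE !dotE dot_perp_perp scalerA; congr (_ *: _).
by field; rewrite k0 d0'.
Qed.

Lemma reflectE d n v : d != 0 -> unit_circle R n -> dot n d = 0 ->
  Defs.reflect n v = mirror d v.
Proof. by move=> d0 n1 nd; rewrite (mirrorE v d0 (unit_neq0 n1) nd) n1 divr1. Qed.

Lemma unit_orth_finite d : d != 0 ->
  finite_set [set v | unit_circle R v /\ dot v d = 0].
Proof.
move=> d0; have d1 := d0; rewrite -dot_gt0 in d1.
pose a := (Num.sqrt (dot d d))^-1.
apply: (@sub_finite_set _ _ [set a *: perp d; (- a) *: perp d]); last exact: finite_set2.
move=> v [v1 dv].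
have [k vE] := perp_colinear d0 dv.
have a2 : a ^+ 2 * dot d d = 1.
  by rewrite /a exprVn sqr_sqrtr ?ltW// mulVf ?gt_eqF.
have k2 : k ^+ 2 * dot d d = 1.
  by rewrite -v1 vE !dotE dot_perp_perp; ring.
have /eqP : k ^+ 2 = a ^+ 2 by apply: (mulIf (lt0r_neq0 d1)); rewrite k2.
by rewrite eqf_sqr => /orP[]/eqP kE; [left|right]; rewrite vE kE.
Qed.

(** * Arcs and regular points *)

Lemma cvg_near_eq (T : Type) (U : topologicalType) (F : set_system T)
    {FF : Filter F} (f g : T -> U) (l : U) :
  f x @[x --> F] --> l -> (\forall x \near F, f x = g x) -> g x @[x --> F] --> l.
Proof.
move=> fl fg; apply: cvg_trans fl; apply: near_eq_cvg.
by apply: filterS fg.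
Qed.

Lemma cvg_dot (T : Type) (F : set_system T) {FF : Filter F} (f g : T -> R * R) u v :
  f x @[x --> F] --> u -> g x @[x --> F] --> v ->
  dot (f x) (g x) @[x --> F] --> dot u v.
Proof.
move=> fu gv.
have fst' (h : T -> R * R) w : h x @[x --> F] --> w -> (h x).1 @[x --> F] --> w.1.
  by move=> hw; apply: (cvg_comp _ _ hw); exact: cvg_fst.
have snd' (h : T -> R * R) w : h x @[x --> F] --> w -> (h x).2 @[x --> F] --> w.2.
  by move=> hw; apply: (cvg_comp _ _ hw); exact: cvg_snd.
by apply: cvgD; apply: cvgM; (apply: fst' || apply: snd').
Qed.

Lemma cvg_perp (T : Type) (F : set_system T) {FF : Filter F} (f : T -> R * R) u :
  f x @[x --> F] --> u -> perp (f x) @[x --> F] --> perp u.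
Proof.
move=> fu; apply: (@cvg_pair _ _ _ F (nbhs (- u.2)) (nbhs u.1) _ _ _
  (fun x => - (f x).2) (fun x => (f x).1)).
  apply: cvgN; apply: (cvg_comp _ _ fu); exact: cvg_snd.
apply: (cvg_comp _ _ fu); exact: cvg_fst.
Qed.

Lemma continuous_dot m : continuous (fun q => dot q m).
Proof. by move=> q; apply: cvg_dot; [exact: cvg_id|exact: cvg_cst]. Qed.

Lemma arc_cvg (c : Defs.arc R) t : t \in `[arc_lo c, arc_hi c] ->
  arc_fun c s @[s --> within `[arc_lo c, arc_hi c] (nbhs t)] --> arc_fun c t.
Proof.
move=> tI.
have h : arc_fun c s @[s --> within `[arc_lo c, arc_hi c] t^'] --> arc_fun c t.
  have l1 : (s - t) @[s --> within `[arc_lo c, arc_hi c] t^'] --> (0 : R).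
    rewrite -(subrr t). apply: cvgB; last exact: cvg_cst.
    by move=> U nU; apply: filterS nU => s Us _ _.
  have H : arc_fun c t + (s - t) *: ((s - t)^-1 *: (arc_fun c s - arc_fun c t))
      @[s --> within `[arc_lo c, arc_hi c] t^'] --> arc_fun c t.
    rewrite -[X in _ --> X]addr0 -(scale0r (arc_der c t)).
    by apply: cvgD; [exact: cvg_cst|apply: cvgZ => //; exact: arc_derE].
  refine (cvg_near_eq H _).
  near=> s.
  have st : s - t != 0.
    rewrite subr_eq0; near: s; by apply: filterS (nbhs_dnbhs_neq t) => s + _.
  by rewrite scalerA mulfV// scale1r addrC subrK.
move=> U nU.
have nn : \forall s \near t, s != t -> s \in `[arc_lo c, arc_hi c] -> U (arc_fun c s).
  exact: (h _ nU).
suff : \forall s \near t, s \in `[arc_lo c, arc_hi c] -> U (arc_fun c s) by [].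
apply: filterS nn => s hs sI; have [->|st] := eqVneq s t; last exact: hs.
exact: nbhs_singleton.
Unshelve. all: by end_near. Qed.

Lemma arc_within_continuous (c : Defs.arc R) :
  {within `[arc_lo c, arc_hi c], continuous (arc_fun c)}.
Proof. by apply/subspace_continuousP => t tI; apply: arc_cvg. Qed.

Lemma near_arc_itv (c : Defs.arc R) t : t \in `]arc_lo c, arc_hi c[ ->
  \forall s \near t, s \in `]arc_lo c, arc_hi c[.
Proof. exact: near_in_itvoo. Qed.

Lemma arc_cvg_inner (c : Defs.arc R) t : t \in `]arc_lo c, arc_hi c[ ->
  arc_fun c s @[s --> t] --> arc_fun c t.
Proof.
move=> tI U nU.
have nn : \forall s \near t, s \in `[arc_lo c, arc_hi c] -> U (arc_fun c s).
  exact: (arc_cvg (subset_itv_oo_cc tI) nU).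
suff : \forall s \near t, U (arc_fun c s) by [].
by apply: filterS2 nn (near_arc_itv tI) => s hs sI; exact/hs/subset_itv_oo_cc.
Qed.

Lemma arc_der_cvg_inner (c : Defs.arc R) t : t \in `]arc_lo c, arc_hi c[ ->
  arc_der c s @[s --> t] --> arc_der c t.
Proof.
move=> tI U nU.
have nn : \forall s \near t, s \in `[arc_lo c, arc_hi c] -> U (arc_der c s).
  have /subspace_continuousP/(_ t (subset_itv_oo_cc tI)) h := arc_der_continuous (a:=c).
  exact: (h _ nU).
suff : \forall s \near t, U (arc_der c s) by [].
by apply: filterS2 nn (near_arc_itv tI) => s hs sI; exact/hs/subset_itv_oo_cc.
Qed.

Lemma arc_quotient_cvg (c : Defs.arc R) t m : t \in `]arc_lo c, arc_hi c[ ->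
  (s - t)^-1 * (dot (arc_fun c s) m - dot (arc_fun c t) m) @[s --> t^'] -->
  dot (arc_der c t) m.
Proof.
move=> tI.
have h : (s - t)^-1 *: (arc_fun c s - arc_fun c t) @[s --> t^'] --> arc_der c t.
  move=> U nU; have nn := arc_derE (subset_itv_oo_cc tI) nU.
  have {}nn : \forall s \near t^', s \in `[arc_lo c, arc_hi c] ->
    U ((s - t)^-1 *: (arc_fun c s - arc_fun c t)) by exact: nn.
  suff : \forall s \near t^', U ((s - t)^-1 *: (arc_fun c s - arc_fun c t)) by [].
  by apply: filterS2 nn (nbhs_dnbhs (near_arc_itv tI)) => s hs sI;
    exact/hs/subset_itv_oo_cc.
refine (cvg_near_eq (cvg_dot h (cvg_cst m)) _).
by near=> s; rewrite !dotE.
Unshelve. all: by end_near. Qed.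

Lemma arc_dot_derive (c : Defs.arc R) t m : t \in `]arc_lo c, arc_hi c[ ->
  is_derive t 1 (fun s => dot (arc_fun c s) m) (dot (arc_der c t) m).
Proof.
move=> tI.
have h : h^-1 *: (dot (arc_fun c (h *: 1 + t)) m - dot (arc_fun c t) m)
   @[h --> 0^'] --> dot (arc_der c t) m.
  have sh : (h *: (1 : R) + t) @[h --> (0 : R)^'] --> t^'.
    have ch : (h *: (1 : R) + t) @[h --> (0 : R)] --> t.
      rewrite -[X in _ --> X]add0r; apply: cvgD; last exact: cvg_cst.
      by rewrite -[X in _ --> X](scale0r (1 : R)); apply: cvgZr_tmp; exact: cvg_id.
    move=> U nU; have := ch _ nU; rewrite /dnbhs /within /= !near_simpl.
    apply: filterS => s h s0; apply: h.
    by rewrite -subr_eq0 addrK scaler_eq0 oner_eq0 orbF.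
  refine (cvg_near_eq (cvg_comp _ _ sh (arc_quotient_cvg (m := m) tI)) _).
  near=> s => /=.
  by rewrite addrK /GRing.scale /= mulr1.
apply: DeriveDef; first by apply/cvg_ex; exists (dot (arc_der c t) m).
exact: cvg_lim h.
Unshelve. all: by end_near. Qed.

Lemma arc_in (S : set (R * R)) (P : piecewise_smooth S) i t :
  t \in `[arc_lo (ps_arc P i), arc_hi (ps_arc P i)] -> S (arc_fun (ps_arc P i) t).
Proof.
move=> tI; have -> := congr1 (fun A => A (arc_fun (ps_arc P i) t)) (ps_cover P).
by exists i => //; exists t.
Qed.

Lemma arc_cover (S : set (R * R)) (P : piecewise_smooth S) q : S q ->
  exists i t, t \in `[arc_lo (ps_arc P i), arc_hi (ps_arc P i)] /\
    arc_fun (ps_arc P i) t = q.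
Proof.
have -> := congr1 (fun A => A q) (ps_cover P).
by move=> [i _ [t tI <-]]; exists i, t.
Qed.

Lemma itvcc_cases t a b : t \in `[a, b] -> [\/ t = a, t = b | t \in `]a, b[].
Proof.
rewrite !in_itv/= => /andP[]; rewrite !le_eqVlt.
move=> /orP[/eqP->|at_]; first by constructor 1.
by move=> /orP[/eqP->|tb]; [constructor 2|constructor 3; rewrite at_].
Qed.

Lemma regular_inner (S : set (R * R)) (P : piecewise_smooth S) i t :
  t \in `[arc_lo (ps_arc P i), arc_hi (ps_arc P i)] ->
  regular_points P (arc_fun (ps_arc P i) t) ->
  t \in `]arc_lo (ps_arc P i), arc_hi (ps_arc P i)[.
Proof.
move=> /itvcc_cases[->|->|//] [_ ns]; exfalso; apply: ns.
  by exists i => //; left.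
by exists i => //; right.
Qed.

Definition arc_end (S : set (R * R)) (P : piecewise_smooth S)
    (k : 'I_(ps_size P) * bool) : R :=
  if k.2 then arc_lo (ps_arc P k.1) else arc_hi (ps_arc P k.1).

Definition end_point (S : set (R * R)) (P : piecewise_smooth S)
    (k : 'I_(ps_size P) * bool) : R * R :=
  arc_fun (ps_arc P k.1) (arc_end k).

Lemma arc_end_in (S : set (R * R)) (P : piecewise_smooth S) (k : 'I_(ps_size P) * bool) :
  arc_end k \in `[arc_lo (ps_arc P k.1), arc_hi (ps_arc P k.1)].
Proof.
have lohi := arc_lt (ps_arc P k.1).
by rewrite /arc_end; case: k.2; rewrite in_itv/= lexx ?andbT ltW.
Qed.

Lemma singular_end (S : set (R * R)) (P : piecewise_smooth S) p :
  singular_points P p -> exists k, p = end_point (P := P) k.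
Proof. by move=> [i _ [->|->]]; [exists (i, true)|exists (i, false)]. Qed.

(** By injectivity and disjointness of the open arcs, a regular point has a
    single parameter; the parameters outside a neighbourhood of it form a
    compact set, whose image stays away from the point. *)
Lemma regular_point_local (S : set (R * R)) (P : piecewise_smooth S) i0 t0 (N : set R) :
  t0 \in `]arc_lo (ps_arc P i0), arc_hi (ps_arc P i0)[ ->
  regular_points P (arc_fun (ps_arc P i0) t0) -> nbhs t0 N ->
  \forall q \near arc_fun (ps_arc P i0) t0, forall i t,
    t \in `[arc_lo (ps_arc P i), arc_hi (ps_arc P i)] ->
    arc_fun (ps_arc P i) t = q -> i = i0 /\ N t.
Proof.
move=> t0I reg Nt0; set p := arc_fun _ t0.
refine (filter_forall (F := nbhs p) (I := 'I_(ps_size P)) (f := fun i q => forall t,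
    t \in `[arc_lo (ps_arc P i), arc_hi (ps_arc P i)] ->
    arc_fun (ps_arc P i) t = q -> i = i0 /\ N t) _ _) => i.
set c := ps_arc P i.
pose A := `[arc_lo c, arc_hi c] `&` (if i == i0 then ~` N° else setT).
have cA : closed A.
  apply: closedI; first exact: itv_closed.
  by case: eqP => _; [apply: open_closedC; exact: open_interior|exact: closedT].
have kA : compact A.
  have sA : A `<=` `[arc_lo c, arc_hi c] by move=> ? [].
  exact: (subclosed_compact cA (@segment_compact _ _ _) sA).
have kK : compact (arc_fun c @` A).
  refine (continuous_compact _ kA).
  have sA : A `<=` `[arc_lo c, arc_hi c] by move=> ? [].
  exact: (continuous_subspaceW sA (@arc_within_continuous c)).
have cK : closed (arc_fun c @` A) by apply: compact_closed kK; exact: norm_hausdorff.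
have npK : (~` (arc_fun c @` A)) p.
  move=> [t [tI /= h] tp].
  have tJ : t \in `]arc_lo c, arc_hi c[.
    by apply: regular_inner; rewrite // -/c tp.
  move: h; case: eqP => [ii|ii _].
    apply; suff -> : t = t0 by [].
    move: tI tp tJ; rewrite /c ii => tI tp tJ.
    exact: (arc_inj (a := ps_arc P i0)).
  have := ps_disjoint (introN eqP ii); rewrite -subset0 => /(_ p); apply.
  by split; [exists t|exists t0].
have oK : open (~` (arc_fun c @` A)) by exact: closed_openC.
have := open_nbhs_nbhs (conj oK npK).
apply: filterS => q nq t tI tq; apply: contrapT => h; apply: nq; exists t => //.
split=> //; case: eqP => // ii; apply: contra_not h => /interior_subset Nt.
by split.
Qed.

(** * Billiard motions *)

Lemma finite_set_min (A : set R) : finite_set A -> A !=set0 ->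
  exists2 t, A t & forall s, A s -> t <= s.
Proof.
move=> /finite_seqP[l ->] [z]; elim: l z => [//|a l IH] z _.
case: l IH => [|b l] IH; first by exists a => [|s] /=; rewrite !inE// => /eqP ->.
have [|t tl h] := IH b; first by rewrite /= inE eqxx.
have [at_|ta] := leP a t.
  exists a => [|s]; rewrite /= inE ?eqxx// => /orP[/eqP->//|sl].
  exact: le_trans at_ (h s sl).
exists t => [|s]; rewrite /= inE; first by apply/orP; right.
by move=> /orP[/eqP->|/h//]; exact: ltW.
Qed.

Lemma affine_eq p q v w a b s t : s != t ->
  p + (s - a) *: v = q + (s - b) *: w -> p + (t - a) *: v = q + (t - b) *: w ->
  v = w /\ forall r, p + (r - a) *: v = q + (r - b) *: w.
Proof.
move=> st es et.
have e : (s - t) *: (v - w) = 0.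
  move: es et; rewrite !pairE => -[e1 e2] [e3 e4].
  by apply: pair_ext; rewrite /=; lra.
have vw : v = w.
  by move/eqP: e; rewrite scaler_eq0 !subr_eq0 (negbTE st) /= => /eqP.
split=> // r; subst w.
have -> : r - a = (s - a) + (r - s) by ring.
have -> : r - b = (s - b) + (r - s) by ring.
by rewrite !(scalerDl v (_ - _) (r - s)) !addrA es.
Qed.

Lemma near_left2 t (Q : set R) : (\forall s \near t^'-, Q s) ->
  exists s1 s2, [/\ s1 < s2, s2 < t, Q s1 & Q s2].
Proof.
move=> h.
have [s1 [s1t Qs1]] : exists s1, s1 < t /\ Q s1.
  by apply: (@filter_ex _ t^'-); apply: filterI => //; exact: nbhs_left_lt.
have [s2 [[s12 s2t] Qs2]] : exists s2, (s1 < s2 /\ s2 < t) /\ Q s2.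
  apply: (@filter_ex _ t^'-); apply: filterI => //; apply: filterI.
    exact: nbhs_left_gt.
  exact: nbhs_left_lt.
by exists s1, s2.
Qed.

(** Being locally affine propagates: the infimum of the times at which the
    motion has left its initial line would be a time around which the motion is
    affine, and agrees with that line on the left. *)
Lemma free_flight B y t1 t2 p w : billiard_motion B y ->
  (\forall s \near t1^'+, y s = p + (s - t1) *: w) ->
  (forall s, t1 < s < t2 -> ~ reflection_instants B y s) ->
  forall s, t1 < s < t2 -> y s = p + (s - t1) *: w.
Proof.
move=> [free _] right1 noref s /andP[t1s st2]; apply: contrapT => ys.
pose Z := [set r | t1 < r <= s /\ y r <> p + (r - t1) *: w].
have Zs : Z s by split=> //; rewrite t1s lexx.
have [e [t1e he]] : exists e, t1 < e /\ forall r, t1 < r < e -> y r = p + (r - t1) *: w.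
  have [e /= e0 he] := right1; exists (t1 + e); split; first by rewrite ltrDl.
  move=> r /andP[t1r re]; apply: he => //=.
  by rewrite distrC ger0_norm ?subr_ge0 1?ltW// ltrBlDl.
have Zinf : has_inf Z by split; [exists s|exists t1 => r [/andP[/ltW]]].
pose z := inf Z.
have t1z : t1 < z.
  apply: (lt_le_trans t1e); apply: lb_le_inf; first by exists s.
  move=> r [/andP[t1r rs] yr]; rewrite leNgt; apply/negP => re.
  by apply: yr; apply: he; rewrite t1r re.
have zs : z <= s by apply: ge_inf => //; case: Zinf.
have zlow r : t1 < r < z -> y r = p + (r - t1) *: w.
  move=> /andP[t1r rz]; apply: contrapT => yr.
  have : z <= r.
    apply: ge_inf; first by case: Zinf.
    by split=> //; rewrite t1r (le_trans (ltW rz)).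
  by rewrite leNgt rz.
have [w0 [_ near0]] := free z (noref z (introT andP (conj t1z (le_lt_trans zs st2)))).
have [s1 [s2 [s12 s2z [Q1 t1s1] [Q2 t1s2]]]] :
  exists s1 s2, [/\ s1 < s2, s2 < z, y s1 = y z + (s1 - z) *: w0 /\ t1 < s1
    & y s2 = y z + (s2 - z) *: w0 /\ t1 < s2].
  apply: near_left2; apply: filterI; last exact: nbhs_left_gt.
  exact: (@cvg_within _ _ _ _ _ near0).
have s1z := lt_trans s12 s2z.
have [_ eqr] : w0 = w /\ forall r, y z + (r - z) *: w0 = p + (r - t1) *: w.
  by apply: (@affine_eq _ _ _ _ _ _ s1 s2); rewrite ?lt_eqF// -?Q1 -?Q2; apply: zlow; rewrite ?t1s1 ?t1s2.
have [e2 /= e20 he2] := near0.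
have [r Zr rz] := inf_adherent e20 Zinf.
case: Zr (Zr) => _ yr Zr; apply: yr.
rewrite he2 ?eqr//= distrC ger0_norm ?ltrBlDl// subr_ge0.
by apply: ge_inf => //; case: Zinf.
Qed.

(** A motion follows the line of its initial data up to the first hit. What
    follows the first reflection is either a free flight to infinity, so that
    the reflected velocity is the final one, or ends at a second reflection. *)
Lemma motion_first_reflection B y x v x' v' t0 :
  regular_motion B y -> initial_data B y x v -> final_data B y x' v' ->
  body_set B (x + t0 *: v) ->
  exists t1 n, let q := x + t1 *: v in
    [/\ t1 <= t0,
        regular_points (body_boundary B) q,
        outer_normal B q n
      & v' = Defs.reflect n v \/
        exists2 s, 0 < s & regular_points (body_boundary B) (q + s *: Defs.reflect n v)].
Proof.
move=> [mot fin] [_ ini] [_ end_] Bt0.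
have I0 : reflection_instants B y !=set0.
  apply/set0P/negP => /eqP I0; have : reflection_instants B y t0.
    by rewrite /reflection_instants/= ini// => s; rewrite I0.
  by rewrite I0.
have [t1 It1 t1min] := finite_set_min fin I0.
have yini t : t <= t1 -> y t = x + t *: v.
  by move=> tt1; apply: ini => s /t1min; exact: le_trans.
have before t : t < t1 -> ~ body_set B (x + t *: v).
  move=> tt1; rewrite -yini ?ltW// => /t1min.
  by rewrite leNgt tt1.
have [reg [w [n [_ outn nleft nright]]]] := mot.2 t1 It1.
have wv : w = v.
  have : \forall s \near t1^'-, s < t1 /\ (s <= t1 -> y s = y t1 + (s - t1) *: w).
    by apply: filterI; [exact: nbhs_left_lt|exact: (@cvg_within _ _ _ _ _ nleft)].
  move=> /near_left2[s1 [s2 [s12 _ [s1t Q1] [s2t Q2]]]].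
  have [] // := @affine_eq (y t1) x w v t1 0 s1 s2.
  - by rewrite lt_eqF.
  - by rewrite -Q1 ?ltW// subr0 yini ?ltW.
  - by rewrite -Q2 ?ltW// subr0 yini ?ltW.
subst w; exists t1, n; rewrite -(yini t1)//=; split=> //.
  by rewrite leNgt; apply/negP => /before.
set w' := Defs.reflect n v.
have right1 : \forall s \near t1^'+, y s = y t1 + (s - t1) *: w'.
  have : \forall s \near t1^'+, t1 < s by exact: nbhs_right_gt.
  apply: filterS2 (@cvg_within _ _ _ _ _ nright) => s h ts.
  by apply: h; exact: ltW.
pose J := reflection_instants B y `&` [set t | t1 < t].
have finJ : finite_set J by apply: sub_finite_set fin => ? [].
have [J0|/set0P J0] := eqVneq J set0.
  left.
  have aft s : t1 < s -> y s = y t1 + (s - t1) *: w'.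
    move=> ts; apply: (@free_flight B y t1 (s + 1)) => //.
      move=> r /andP[tr _] Ir; have : J r by [].
      by rewrite J0.
    by rewrite ts ltrDl ltr01.
  have late s : t1 < s -> y s = x' + s *: v'.
    move=> ts; apply: end_ => r Ir; rewrite leNgt; apply/negP => sr.
    have : J r by split=> //=; exact: lt_trans sr.
    by rewrite J0.
  have eqs s : t1 < s -> x' + (s - 0) *: v' = y t1 + (s - t1) *: w'.
    by move=> ts; rewrite subr0 -late// aft.
  have t12 : t1 + 1 != t1 + 2.
    by rewrite (inj_eq (addrI _)) lt_eqF// ltr1n.
  have h1 : t1 < t1 + 1 by rewrite ltrDl ltr01.
  have h2 : t1 < t1 + 2 by rewrite ltrDl ltr0n.
  by have [] := affine_eq t12 (eqs _ h1) (eqs _ h2).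
have [t2 [It2 t12] t2min] := finite_set_min finJ J0.
right; exists (t2 - t1); first by rewrite subr_gt0.
have [reg2 [w2 [_ [_ _ nleft2 _]]]] := mot.2 t2 It2.
have aft s : t1 < s < t2 -> y s = y t1 + (s - t1) *: w'.
  apply: (@free_flight B) => // r /andP[tr rt2] Ir.
  have /t2min : J r by [].
  by rewrite leNgt rt2.
have : \forall s \near t2^'-, s < t2 /\ (t1 < s /\ (s <= t2 -> y s = y t2 + (s - t2) *: w2)).
  apply: filterI; first exact: nbhs_left_lt.
  apply: filterI; first exact: nbhs_left_gt.
  exact: (@cvg_within _ _ _ _ _ nleft2).
move=> /near_left2[s1 [s2 [s12 _ [s1t [ts1 Q1]] [s2t [ts2 Q2]]]]].
have [_ /(_ t2)] := @affine_eq (y t2) (y t1) w2 w' t2 t1 s1 s2 (negbT (lt_eqF s12))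
  (etrans (esym (Q1 (ltW s1t))) (aft s1 (introT andP (conj ts1 s1t))))
  (etrans (esym (Q2 (ltW s2t))) (aft s2 (introT andP (conj ts2 s2t)))).
by rewrite subrr scale0r addr0 => <-.
Qed.

Lemma reflectK n w : unit_circle R n -> Defs.reflect n (Defs.reflect n w) = w.
Proof.
move=> n1; rewrite /Defs.reflect dotBl dotZl n1 mulr1; set k := dot w n.
by apply: pair_ext; rewrite !pairE /=; ring.
Qed.

Lemma reflectN n w : Defs.reflect n (- w) = - Defs.reflect n w.
Proof. by rewrite /Defs.reflect !dotE mulrN scaleNr opprK opprB addrC. Qed.

Lemma unit_reflect n w : unit_circle R n -> unit_circle R w ->
  unit_circle R (Defs.reflect n w).
Proof.
rewrite /unit_circle/= => n1 w1; rewrite /Defs.reflect !dotE n1 w1 (dotC n w).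
by ring.
Qed.

Lemma nbhs_flip c t (Q : set R) : (\forall s \near c - t, Q s) ->
  \forall s \near t, Q (c - s).
Proof.
suff : (c - s) @[s --> t] --> c - t by move=> h /h.
by apply: cvgB; [exact: cvg_cst|exact: cvg_id].
Qed.

Lemma motion_reverse B y c : billiard_motion B y -> billiard_motion B (fun t => y (c - t)).
Proof.
move=> [free refl]; split=> t.
  move=> /(free (c - t))[w [w1 nw]]; exists (- w); split; first exact: unit_opp.
  apply: filterS (nbhs_flip nw) => s ->.
  by rewrite scalerN -scaleNr; congr (_ + _ *: _); ring.
move=> /(refl (c - t))[reg [w [n [w1 outn nl nr]]]]; split=> //.
have n1 : unit_circle R n by case: outn.
exists (- Defs.reflect n w), n; split=> //.
- exact/unit_opp/unit_reflect.
- apply: filterS (nbhs_flip nr) => s h st; rewrite h; last by rewrite lerD2l lerN2.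
  by rewrite scalerN -scaleNr; congr (_ + _ *: _); ring.
- apply: filterS (nbhs_flip nl) => s h st; rewrite h; last by rewrite lerD2l lerN2.
  by rewrite reflectN reflectK// scalerN -scaleNr; congr (_ + _ *: _); ring.
Qed.

(** Time reversal exchanges initial and final data, and an unperturbed motion
    has the same line at both ends; a time shift by the displacement along that
    line makes the reversed motion start with the prescribed data. *)
Lemma invisible_opp B v : unit_circle R v -> invisible B v -> invisible B (- v).
Proof.
move=> v1; apply: negligibleS; apply: subsetC => x [y [x' [v' [[mot fin] [_ ini] [_ end_] [vv [k xk]]]]]].
subst v'; have {xk}x'E : x' = x + k *: v by rewrite -xk addrC subrK.
exists (fun t => y (- k - t)), (x - k *: v), (- v).
have refl t : reflection_instants B (fun t => y (- k - t)) t =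
  reflection_instants B y (- k - t) by [].
split.
- split; first exact: motion_reverse.
  apply: sub_finite_set (finite_image (fun t => - k - t) fin) => t It.
  by exists (- k - t) => //; ring.
- split; first exact: unit_opp.
  move=> t h; rewrite end_ => [|s Is].
    rewrite x'E -addrA -scalerDl scalerN -scaleNr; congr (_ + _ *: _); ring.
  have : t <= - k - s by apply: h; rewrite refl; congr reflection_instants : Is; ring.
  by lra.
- split; first exact: unit_opp.
  move=> t h; rewrite ini => [|s Is].
    by rewrite scalerBl scaleNr addrA scalerN.
  have : - k - s <= t by apply: h; rewrite refl; congr reflection_instants : Is; ring.
  by lra.
- split=> //; exists k; by rewrite addrC addKr scalerN.
Qed.

(** * Stability of rays and of transversal hits *)

Lemma ae_not_near (P : R * R -> Prop) (x : R * R) :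
  {ae (@lebesgue_measure R \x @lebesgue_measure R)%E, forall x, P x} ->
  ~ (\forall y \near x, ~ P y).
Proof.
move=> [N [mN N0 PN]] h.
have [e /= e0 he] : exists2 e : R, 0 < e & ball x e `<=` [set y | ~ P y].
  have [e /= e0 he] := (nbhs_ballP _ _).1 h; by exists e.
pose A (a : R) : set R := `]a - e, a + e[%classic.
have sub : A x.1 `*` A x.2 `<=` N.
  by move=> y [y1 y2]; apply: PN; apply: he; split => /=; rewrite ball_itv.
have mA a : measurable (A a) by exact: measurable_itv.
have : ((@lebesgue_measure R \x @lebesgue_measure R)%E (A x.1 `*` A x.2) <= 0)%E.
  rewrite -N0; apply: le_measure => //; rewrite inE.
    by apply: measurableX; exact: mA.
  exact: mN.
rewrite product_measure1E; [|exact: mA|exact: mA].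
have lA a : lebesgue_measure (A a) = (e *+ 2)%:E.
  rewrite /A lebesgue_measure_itv /= lte_fin ltrD2l gtrN // -EFinB; congr (_%:E).
  by rewrite opprB addrC addrA subrK -mulr2n.
rewrite (_ : (_ * _)%E = ((e *+ 2) * (e *+ 2))%:E); last first.
  by rewrite EFinM; congr (_ * _)%E; exact: lA.
by rewrite lee_fin leNgt mulr_gt0// pmulrn_lgt0.
Qed.

(** For a point [q] of a compact set, lying off the part [a <= s] of the ray
    from [p] along [u] is an open condition on [(p, u)] and [q]: in
    terms of [dot] it is the failure of an equality or of a large inequality. *)
Lemma ray_robust (K : set (R * R)) p u a : compact K -> u != 0 ->
  (forall s, a <= s -> ~ K (p + s *: u)) ->
  \forall z \near (p, u), forall s, a <= s -> ~ K (z.1 + s *: z.2).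
Proof.
move=> kK u0 free.
have uu0 : 0 < dot u u by rewrite dot_gt0.
pose Q (z : (R * R) * (R * R)) q :=
  ~ (dot (q - z.1) (perp z.2) = 0 /\ a * dot z.2 z.2 <= dot (q - z.1) z.2).
have : \forall z \near (p, u), K `<=` Q z.
  refine ((compact_near_coveringP K).1 kK _ (nbhs (p, u)) Q _ _) => q Kq.
  set F := filter_prod (nbhs q) (nbhs (p, u)).
  have c1 : x.1 @[x --> F] --> q by exact: cvg_fst.
  have c2 : x.2 @[x --> F] --> (p, u) by exact: cvg_snd.
  have cp : x.2.1 @[x --> F] --> p by apply: (cvg_comp _ _ c2); exact: cvg_fst.
  have cu : x.2.2 @[x --> F] --> u by apply: (cvg_comp _ _ c2); exact: cvg_snd.
  have cd : (x.1 - x.2.1) @[x --> F] --> q - p by apply: cvgB.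
  suff : \forall x \near F, Q x.2 x.1 by [].
  have [e|ne] := eqVneq (dot (q - p) (perp u)) 0; last first.
    have cn : dot (x.1 - x.2.1) (perp x.2.2) @[x --> F] --> dot (q - p) (perp u).
      by apply: cvg_dot => //; exact: cvg_perp.
    by apply: filterS (cvgr_neq0 _ cn ne) => x /eqP xn [].
  have lt : 0 < a * dot u u - dot (q - p) u.
    rewrite subr_gt0 ltNge; apply/negP => le.
    have pu0 : perp u != 0 by rewrite -dot_gt0 dot_perp_perp.
    have [k kE] := perp_colinear pu0 e.
    have uE : perp (perp u) = - u by apply: pair_ext.
    have qE : q = p + (- k) *: u.
      by rewrite scaleNr -scalerN -uE -kE addrC subrK.
    apply: (free (- k)); last by rewrite -qE.
    move: le; rewrite qE addrC addKr dotZl.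
    by rewrite ler_pM2r.
  have cl : (a * dot x.2.2 x.2.2 - dot (x.1 - x.2.1) x.2.2) @[x --> F] -->
      a * dot u u - dot (q - p) u.
    apply: cvgB; last exact: cvg_dot.
    by apply: cvgM; [exact: cvg_cst|exact: cvg_dot].
  by apply: filterS (cvgr_gt _ cl _ lt) => x xl [_]; rewrite leNgt -subr_gt0 xl.
apply: filterS => z h s as_ Ks; apply: (h _ Ks).
rewrite addrC addKr !dotZl dot_perp mulr0; split=> //.
by rewrite ler_wpM2r// /dot -!expr2 addr_ge0 ?sqr_ge0.
Qed.

Lemma mirror_cvg (T : Type) (F : set_system T) {FF : Filter F} (f : T -> R * R) d v :
  f x @[x --> F] --> d -> d != 0 -> mirror (f x) v @[x --> F] --> mirror d v.
Proof.
move=> fd d0; apply: cvgB; first exact: cvg_cst.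
have cp : perp (f x) @[x --> F] --> perp d by exact: cvg_perp.
apply: cvgZ => //; apply: cvgM; last first.
  by apply: cvgV; [rewrite gt_eqF ?dot_gt0|exact: cvg_dot].
by apply: cvgM; [exact: cvg_cst|apply: cvg_dot => //; exact: cvg_cst].
Qed.

Lemma short_ray p u (U : set (R * R)) : nbhs p U ->
  exists2 e : R, 0 < e & \forall z \near (p, u), forall s, `|s| <= e -> U (z.1 + s *: z.2).
Proof.
move=> nU.
have c : (x.1.1 + x.2 *: x.1.2) @[x --> filter_prod (nbhs (p, u)) (nbhs (0 : R))] --> p.
  set F := filter_prod _ _.
  have c1 : x.1 @[x --> F] --> (p, u) by exact: cvg_fst.
  have c2 : x.2 @[x --> F] --> (0 : R) by exact: cvg_snd.
  rewrite -[X in _ --> X]addr0 -(scale0r u).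
  apply: cvgD; first by apply: (cvg_comp _ _ c1); exact: cvg_fst.
  by apply: cvgZ => //; apply: (cvg_comp _ _ c1); exact: cvg_snd.
have [[A1 A2] /= [nA1 nA2] h] := c _ nU.
have [e /= e0 he] := (nbhs_ballP _ _).1 nA2.
exists (e / 2); first by rewrite divr_gt0.
apply: filterS nA1 => z zA s se.
apply: (h (z, s)); split => //=; apply: he.
by rewrite /ball /= sub0r normrN (le_lt_trans se)// ltr_pdivrMr// ltr_pMr// ltr1n.
Qed.

(** The intermediate value theorem for the coordinate [dot _ (perp v)] of the
    arc, which crosses its value at [t0] with non-zero speed. *)
Lemma near_hit (c : Defs.arc R) t0 v e : unit_circle R v ->
  t0 \in `]arc_lo c, arc_hi c[ -> dot (arc_der c t0) (perp v) != 0 -> 0 < e ->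
  \forall x \near arc_fun c t0, exists s t,
    [/\ `|s| <= e, t \in `]arc_lo c, arc_hi c[ & x + s *: v = arc_fun c t].
Proof.
move=> v1 t0I; set p := arc_fun c t0; set k := dot _ (perp v) => k0 e0.
have inner_cvg t m : t \in `]arc_lo c, arc_hi c[ ->
    dot (arc_fun c s) m @[s --> t] --> dot (arc_fun c t) m.
  by move=> tI; apply: cvg_dot; [exact: arc_cvg_inner|exact: cvg_cst].
have e2 : 0 < e / 2 by rewrite divr_gt0.
have [r /= r0 hr] : exists2 r : R, 0 < r & ball t0 r `<=`
    [set t | [/\ t \in `]arc_lo c, arc_hi c[, `|dot (arc_fun c t - p) v| < e / 2
      & t != t0 -> 0 < (t - t0)^-1 * (dot (arc_fun c t) (perp v) - dot p (perp v)) * k]].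
  have c1 : dot (arc_fun c t - p) v @[t --> t0] --> (0 : R).
    have -> : 0 = dot p v - dot p v by rewrite subrr.
    rewrite (_ : (fun t => dot (arc_fun c t - p) v) =
      (fun t => dot (arc_fun c t) v - dot p v)); last by apply/funext => t; rewrite dotBl.
    by apply: cvgB; [exact: inner_cvg|exact: cvg_cst].
  have n1 : \forall t \near t0, `|dot (arc_fun c t - p) v| < e / 2.
    by apply: (cvgr_norm_lt _ c1); rewrite normr0.
  have c2 : (t - t0)^-1 * (dot (arc_fun c t) (perp v) - dot p (perp v)) * k
      @[t --> t0^'] --> k * k.
    by apply: cvgM; [exact: arc_quotient_cvg|exact: cvg_cst].
  have kk : 0 < k * k by rewrite -expr2 exprn_even_gt0.
  have n2 : \forall t \near t0, t != t0 ->
      0 < (t - t0)^-1 * (dot (arc_fun c t) (perp v) - dot p (perp v)) * k.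
    exact: (cvgr_gt _ c2 _ kk).
  apply/nbhs_ballP; apply: filterS3 (near_arc_itv t0I) n1 n2 => t ? ? ?; by split.
pose H t := k * dot (arc_fun c t) (perp v).
have r2 : 0 < r / 2 by rewrite divr_gt0.
have inb t : t0 - r / 2 <= t <= t0 + r / 2 -> ball t0 r t.
  by move=> /andP[ta tb]; rewrite /ball /= ltr_norml; lra.
have [_ _] := hr _ (inb (t0 + r / 2) ltac:(lra)).
have -> : t0 + r / 2 - t0 = r / 2 by ring.
rewrite -subr_eq0 (_ : _ - _ = r / 2) ?gt_eqF//; last by ring.
move=> /(_ isT); rewrite -mulrA pmulr_rgt0 ?invr_gt0// => Hb.
have [_ _] := hr _ (inb (t0 - r / 2) ltac:(lra)).
have -> : t0 - r / 2 - t0 = - (r / 2) by ring.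
rewrite -subr_eq0 (_ : _ - _ = - (r / 2)) ?oppr_eq0 ?gt_eqF//; last by ring.
move=> /(_ isT); rewrite -mulrA invrN mulNr oppr_gt0 pmulr_rlt0 ?invr_gt0// => Ha.
have cx m : dot x m @[x --> p] --> dot p m by exact: continuous_dot.
have n1 : \forall x \near p, `|dot p v - dot x v| < e / 2.
  have c1 : dot p v - dot x v @[x --> p] --> dot p v - dot p v.
    by apply: cvgB; [exact: cvg_cst|exact: cx].
  by apply: (cvgr_norm_lt _ c1); rewrite subrr normr0.
have ck : k * dot x (perp v) @[x --> p] --> H t0.
  by apply: cvgM; [exact: cvg_cst|exact: cx].
have n2 : \forall x \near p, k * dot x (perp v) < H (t0 + r / 2).
  by apply: (cvgr_lt _ ck); rewrite /H -/p; lra.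
have n3 : \forall x \near p, H (t0 - r / 2) < k * dot x (perp v).
  by apply: (cvgr_gt _ ck); rewrite /H -/p; lra.
apply: filterS3 n1 n2 n3 => x x1 x2 x3.
have Hc : {within `[t0 - r / 2, t0 + r / 2], continuous H}.
  apply: continuous_in_subspaceT => t /set_mem/= tI.
  have [tJ _ _] := hr _ (inb t tI).
  by apply: cvgM; [exact: cvg_cst|exact: inner_cvg].
have ab : t0 - r / 2 <= t0 + r / 2 by lra.
have mid : Num.min (H (t0 - r / 2)) (H (t0 + r / 2)) <= k * dot x (perp v)
    <= Num.max (H (t0 - r / 2)) (H (t0 + r / 2)).
  by rewrite ge_min le_max (ltW x2) (ltW x3) orbT.
have [t tI Ht] := IVT ab Hc mid.
have [tJ t1 _] := hr _ (inb t tI).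
exists (dot (arc_fun c t - x) v), t; split=> //.
  move: t1 x1; rewrite !dotBl !ltr_norml ler_norml; lra.
have ctx : arc_fun c t - x - dot (arc_fun c t - x) v *: v = 0.
  set z := arc_fun c t - x.
  apply: (frame_eq0 (frame_perp v1)); rewrite [LHS]dotBl dotZl.
    by rewrite v1 mulr1 subrr.
  rewrite dot_perp mulr0 subr0 /z dotBl.
  by apply/eqP; rewrite subr_eq0; apply/eqP/(mulfI k0).
by apply/eqP; rewrite eq_sym -subr_eq0 opprD addrA ctx.
Qed.

(** * A motion with a single reflection *)

(** Rolle's theorem for the coordinate [dot _ m] of the arc. *)
Lemma arc_chord (c : Defs.arc R) a b m : a < b ->
  (forall t, t \in `[a, b] -> (t \in `]arc_lo c, arc_hi c[) /\ dot (arc_der c t) m != 0) ->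
  dot (arc_fun c a) m != dot (arc_fun c b) m.
Proof.
move=> ab h; apply/negP => /eqP e.
have [t tI|t|t tI Dt] := @Rolle R (fun t => dot (arc_fun c t) m) a b ab _ _ e.
- by have [tJ _] := h t (subset_itv_oo_cc tI); have [] := arc_dot_derive m tJ.
- apply: continuous_in_subspaceT => {}t /set_mem/= tI; have [tJ _] := h t tI.
  by apply: cvg_dot; [exact: arc_cvg_inner|exact: cvg_cst].
have [tJ /eqP] := h t (subset_itv_oo_cc tI); apply.
have D := arc_dot_derive m tJ.
by have := @derive_val _ _ _ _ _ _ _ D; rewrite (derive_val (is_derive := Dt)).
Qed.

Lemma boundary_sub B q : boundary (body_set B) q -> body_set B q.
Proof.
have cB : closed (body_set B) by apply: compact_closed (@body_compact _ B); exact: norm_hausdorff.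
by move=> [+ _]; exact: cB.
Qed.

(** One motion that meets [B] at a single regular point, transversally, already
    forbids invisibility, because the situation persists for all nearby initial
    data. They first hit [B] near [p], hence on the same arc, and leave in a
    direction close to the original one. At a distance the outgoing ray is
    free by compactness; close to [p] it could only return to the same arc,
    along a chord, which is nearly tangent and so not parallel to the outgoing
    direction. The final velocity is thus the reflected one, which is not [v]. *)
Lemma single_reflection B v i t0 :
  let c := ps_arc (body_boundary B) i in
  let p := arc_fun c t0 in
  let d := arc_der c t0 in
  unit_circle R v -> t0 \in `]arc_lo c, arc_hi c[ ->
  regular_points (body_boundary B) p -> dot v (perp d) != 0 ->
  (forall s, 0 < s -> ~ body_set B (p - s *: v)) ->
  (forall s, 0 < s -> ~ body_set B (p + s *: mirror d v)) ->
  ~ invisible B v.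
Proof.
move=> c p d v1 t0I reg vd before after /ae_not_near inv; apply: (inv p) => {inv}.
have d0 : d != 0 by apply: arc_der_neq0; exact: subset_itv_oo_cc.
have dd : dot d d != 0 by rewrite gt_eqF ?dot_gt0.
pose w t := mirror (arc_der c t) v.
have der_cvg := arc_der_cvg_inner t0I.
have w_cvg : w t @[t --> t0] --> w t0 by exact: mirror_cvg.
have wd : dot (w t0) (perp d) = - dot v (perp d).
  by rewrite /w /mirror -/d dotBl dotZl dot_perp_perp; field.
have w0 : w t0 != 0.
  by apply: contraNneq vd => w0; move: wd; rewrite w0 /dot /= !mul0r addr0 => /eqP; rewrite eq_sym oppr_eq0.
have v0 : v != 0 := unit_neq0 v1.
(* by [arc_chord], this prevents chords near [p] from being parallel to
   outgoing directions *)
have [r r0 hr] : exists2 r : R, 0 < r & forall t t', ball t0 r t -> ball t0 r t' ->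
    (t \in `]arc_lo c, arc_hi c[) /\ dot (arc_der c t) (perp (w t')) != 0.
  set F := filter_prod (nbhs t0) (nbhs t0).
  have c1 : x.1 @[x --> F] --> t0 by exact: cvg_fst.
  have c2 : x.2 @[x --> F] --> t0 by exact: cvg_snd.
  have cv : dot (arc_der c x.1) (perp (w x.2)) @[x --> F] --> dot d (perp (w t0)).
    apply: cvg_dot; first exact: cvg_comp c1 der_cvg.
    by apply: cvg_perp; exact: cvg_comp c2 w_cvg.
  have nz : dot d (perp (w t0)) != 0.
    by rewrite -oppr_eq0 -dot_perpl dotC wd oppr_eq0.
  have [[A1 A2] /= [nA1 nA2] hA] := cvgr_neq0 _ cv nz.
  have nA : nbhs t0 (A1 `&` A2 `&` [set t | t \in `]arc_lo c, arc_hi c[]).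
    by apply: filterI; [exact: filterI|exact: near_arc_itv].
  have [r /= r0 hr] := (nbhs_ballP _ _).1 nA; exists r => // t t' /hr[[tA1 _] tI] /hr[[_ tA2] _].
  by split=> //; apply: (hA (t, t')).
pose near_only (N : set R) := [set q | forall j t,
  t \in `[arc_lo (ps_arc (body_boundary B) j), arc_hi (ps_arc (body_boundary B) j)] ->
  arc_fun (ps_arc (body_boundary B) j) t = q -> j = i /\ N t].
have only (N : set R) : nbhs t0 N -> nbhs p (near_only N).
  by move=> nN; exact: regular_point_local t0I reg nN.
pose U := near_only (ball t0 r).
have nU : nbhs p U by apply/only/nbhsx_ballx.
have [e e0 short] := short_ray (w t0) nU.
have kB := @body_compact _ B.
have far : \forall z \near (p, w t0), forall s, e <= s -> ~ body_set B (z.1 + s *: z.2).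
  by apply: ray_robust => // s es; apply: after; exact: lt_le_trans es.
have pw_cvg : (arc_fun c t, w t) @[t --> t0] --> (p, w t0).
  by apply: (@cvg_pair _ _ _ _ (nbhs p) (nbhs (w t0))) => //; exact: arc_cvg_inner.
have n1 : \forall t \near t0, forall s, `|s| <= e -> U (arc_fun c t + s *: w t).
  exact: (pw_cvg _ short).
have n2 : \forall t \near t0, forall s, e <= s -> ~ body_set B (arc_fun c t + s *: w t).
  exact: (pw_cvg _ far).
have n3 : \forall t \near t0, dot v (perp (arc_der c t)) != 0.
  have cv : dot v (perp (arc_der c t)) @[t --> t0] --> dot v (perp d).
    by apply: cvg_dot; [exact: cvg_cst|exact: cvg_perp].
  exact: cvgr_neq0 _ cv vd.
pose N := [set t | [/\ forall s, `|s| <= e -> U (arc_fun c t + s *: w t),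
  forall s, e <= s -> ~ body_set B (arc_fun c t + s *: w t) & dot v (perp (arc_der c t)) != 0]].
have nN : nbhs t0 (N `&` ball t0 r).
  apply: filterI; last exact: nbhsx_ballx.
  by apply: filterS3 n1 n2 n3 => t ? ? ?; split.
have [e' e'0 short'] := short_ray v (only _ nN).
have x_cvg u : (x, u) @[x --> p] --> (p, u).
  by apply: (@cvg_pair _ _ _ _ (nbhs p) (nbhs u)) => //; exact: cvg_cst.
have m1 : \forall x \near p, forall s, `|s| <= e' -> near_only (N `&` ball t0 r) (x + s *: v).
  exact: (x_cvg v _ short').
have free' : \forall z \near (p, - v), forall s, e' <= s -> ~ body_set B (z.1 + s *: z.2).
  apply: ray_robust; rewrite ?oppr_eq0// => s es; rewrite scalerN; apply: before.
  exact: lt_le_trans es.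
have m2 : \forall x \near p, forall s, e' <= s -> ~ body_set B (x + s *: - v).
  exact: (x_cvg (- v) _ free').
have dv : dot (arc_der c t0) (perp v) != 0.
  by rewrite -oppr_eq0 -dot_perpl dotC.
have m3 := near_hit v1 t0I dv e'0.
apply: filterS3 m1 m2 m3 => x /= m1 m2 [s0 [th [s0e thI xs0]]].
move=> [y [x' [v' [mot ini fin [vv _]]]]]; subst v'.
have Bx : body_set B (x + s0 *: v).
  rewrite xs0; apply: boundary_sub; apply: (arc_in (P := body_boundary B)).
  exact: subset_itv_oo_cc.
have [t1 [n [t10 regq [n1' [j [t [tI tq nd]]] _] esc]]] :=
  motion_first_reflection mot ini fin Bx.
set q := x + t1 *: v in regq tq esc.
have t1e : `|t1| <= e'.
  rewrite ler_norml (le_trans t10 (le_trans (ler_norm s0) s0e)) andbT.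
  rewrite lerNl leNgt; apply/negP => /ltW /m2; apply.
  by rewrite scalerN scaleNr opprK; apply: boundary_sub; case: regq.
have [ji [[Ns Nf Nv] tr]] := m1 t1 t1e j t (subset_itv_oo_cc tI) tq.
subst j; rewrite -/c in tI tq nd.
have rw : Defs.reflect n v = w t.
  by apply: reflectE => //; apply: arc_der_neq0; exact: subset_itv_oo_cc.
have dt : arc_der c t != 0 by apply: arc_der_neq0; exact: subset_itv_oo_cc.
have ddt : dot (arc_der c t) (arc_der c t) != 0 by rewrite gt_eqF ?dot_gt0.
rewrite rw in esc; case: esc => [vw|[s s0' regs]].
  have : dot v (perp (arc_der c t)) = - dot v (perp (arc_der c t)).
    rewrite {1}vw /w /mirror dotBl dotZl dot_perp_perp; by field.
  by move/eqP; rewrite -subr_eq0 opprK -mulr2n mulrn_eq0 /= (negbTE Nv).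
rewrite -tq in regs.
have Bs := boundary_sub regs.1.
have se : s < e by rewrite ltNge; apply/negP => /Nf.
have [j [t' [t'I t'q]]] := arc_cover (body_boundary B) regs.1.
have abs_s : `|s| <= e by rewrite gtr0_norm// ltW.
have [ji t'r] := Ns s abs_s j t' t'I t'q.
subst j; rewrite -/c in t'I t'q.
have wt : dot (arc_fun c t') (perp (w t)) = dot (arc_fun c t) (perp (w t)).
  by rewrite t'q dotDl dotZl dot_perp mulr0 addr0.
have inb a b : a < b -> ball t0 r a -> ball t0 r b -> forall z, z \in `[a, b] -> ball t0 r z.
  by move=> ab ha hb z; rewrite in_itv/= => /andP[za zb]; move: ha hb;
    rewrite /ball /= !ltr_norml; lra.
have [tt'|tt'|tt'] := ltgtP t t'.
- have := @arc_chord c t t' (perp (w t)) tt' (fun z zI => hr z t (inb _ _ tt' tr t'r z zI) tr).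
  by rewrite wt eqxx.
- have := @arc_chord c t' t (perp (w t)) tt' (fun z zI => hr z t (inb _ _ tt' t'r tr z zI) tr).
  by rewrite wt eqxx.
have : s *: w t = 0 by apply: (addrI (arc_fun c t)); rewrite addr0 -t'q tt'.
have [_] := hr t t tr tr.
move=> + /eqP; rewrite scaler_eq0 (gt_eqF s0')/= => + /eqP wt0.
by rewrite wt0 /dot /= oppr0 !mulr0 addr0 eqxx.
Qed.

(** * Contact with a parabola *)

(** With [x = dot (q - f) v] and [y = dot (q - f) m], the equation
    [y ^+ 2 + 2 * c * x = c ^+ 2] is that of the parabola of focus [f] and axis
    [v] on which [x + sqrt (x ^+ 2 + y ^+ 2) = c]. Here [c] is the minimum over
    [K] of that expression, the length of the path that runs along [v] up to
    [q] and then straight to [f]. Since [f] is off the lines of direction [v]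
    that meet [K], the minimum is positive. *)
Lemma parabola_contact (K : set (R * R)) v m f : compact K -> K !=set0 ->
  (forall q, K q -> dot (q - f) m < 0) ->
  exists c p, [/\ 0 < c, K p,
    dot (p - f) m ^+ 2 + 2 * c * dot (p - f) v = c ^+ 2
    & forall q, K q -> c ^+ 2 <= dot (q - f) m ^+ 2 + 2 * c * dot (q - f) v].
Proof.
move=> kK K0 below.
pose X q := dot (q - f) v; pose Y q := dot (q - f) m.
pose S q := Num.sqrt (X q * X q + Y q * Y q).
have dc (m' : R * R) : continuous (fun q => dot (q - f) m').
  move=> q; apply: cvg_dot; last exact: cvg_cst.
  by apply: cvgB; [exact: cvg_id|exact: cvg_cst].
have Sc : continuous S.
  move=> q.
  have c1 : (X x * X x + Y x * Y x) @[x --> q] --> X q * X q + Y q * Y q.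
    by apply: cvgD; apply: cvgM; exact: dc.
  exact: (cvg_comp _ _ c1 (@sqrt_continuous R _)).
have fc : {within K, continuous (fun q => X q + S q)}.
  apply: continuous_subspaceT => q; apply: cvgD; [exact: dc|exact: Sc].
have [p /set_mem Kp pmin] := compact_EVT_min K0 kK fc.
have S0 q : 0 <= S q by exact: sqrtr_ge0.
have S2 q : S q ^+ 2 = X q ^+ 2 + Y q ^+ 2.
  by rewrite sqr_sqrtr ?expr2// addr_ge0// -expr2 sqr_ge0.
exists (X p + S p), p.
have c0 : 0 < X p + S p.
  rewrite ltNge; apply/negP => le.
  by have := S2 p; have := S0 p; have := below p Kp; rewrite -/(Y p); nra.
split=> //; first by rewrite -/(X p) -/(Y p); have := S2 p; lra.
move=> q Kq; have := pmin q (mem_set Kq).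
rewrite -/(X q) -/(Y q); set c := X p + S p in c0 *; move=> cq.
have := S2 q; have := S0 q; have [cX|Xc] := leP (X q) c; nra.
Qed.

Lemma boundary_exit B p u : body_set B p -> (forall s, 0 < s -> ~ body_set B (p + s *: u)) ->
  boundary (body_set B) p.
Proof.
move=> Bp out; split; first exact: subset_closure.
move=> nB.
have c : p + s *: u @[s --> (0 : R)^'+] --> p.
  rewrite -[X in _ --> X]addr0 -(scale0r u); apply: cvgD; first exact: cvg_cst.
  apply: cvgZ; last exact: cvg_cst.
  exact: cvg_at_right_filter.
have h : \forall s \near (0 : R)^'+, body_set B (p + s *: u) by exact: (c _ nB).
have : \forall s \near (0 : R)^'+, False.
  by apply: filterS2 h (nbhs_right_gt 0) => s Bs s0; exact: (out s).
by move=> /filter_ex[].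
Qed.

(** The optical property of the parabola: a particle coming along its axis is
    sent by the contact point [p] to the focus. No point of [B] is inside the
    parabola, where the path up to the focus lies, nor beyond the focus, where the
    path is above the whole body. So this is a motion with one reflection. *)
Lemma parabola_visible B v m f c p : frame v m ->
  (forall q, body_set B q -> dot (q - f) m < 0) -> 0 < c -> body_set B p ->
  dot (p - f) m ^+ 2 + 2 * c * dot (p - f) v = c ^+ 2 ->
  (forall q, body_set B q -> c ^+ 2 <= dot (q - f) m ^+ 2 + 2 * c * dot (q - f) v) ->
  ~ singular_points (body_boundary B) p ->
  ~ invisible B v.
Proof.
move=> fvm below c0 Bp; set x := dot (p - f) v; set y := dot (p - f) m => pE Bge pns.
have vm := frame_orth fvm; have m1 := frame_unit fvm; have [v1 mv] := fvm.
have y0 : y < 0 by exact: below.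
have before s : 0 < s -> ~ body_set B (p - s *: v).
  move=> s0 /Bge; rewrite addrAC !(dotBl _ (s *: v)) !dotZl v1 vm -/x -/y.
  by nra.
have bp : boundary (body_set B) p.
  by apply: (@boundary_exit _ _ (- v)) => // s; rewrite scalerN; exact: before.
have [i [t0 [t0I t0p]]] := arc_cover (body_boundary B) bp.
have reg : regular_points (body_boundary B) (arc_fun (ps_arc (body_boundary B) i) t0).
  by rewrite t0p.
have t0J := regular_inner t0I reg.
set a := ps_arc (body_boundary B) i in t0I t0p reg t0J.
set d := arc_der a t0.
have d0 : d != 0 by exact: arc_der_neq0.
(* [p] minimises along its arc the function that defines the parabola *)
have tangent : dot (c *: v + y *: m) d = 0.
  pose X t := dot (arc_fun a t) v; pose Y t := dot (arc_fun a t) m.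
  pose g : R -> R := (Y - cst (dot f m)) * (Y - cst (dot f m)) + cst (2 * c) * X.
  have gE t : g t = dot (arc_fun a t - f) m ^+ 2 + 2 * c * dot (arc_fun a t - f) v
     + 2 * c * dot f v.
    by rewrite /g /X /Y !dotBl !fctE /=; ring.
  have gD t : t \in `]arc_lo a, arc_hi a[ -> is_derive t 1 g
      (2 * (Y t - dot f m) * dot (arc_der a t) m + 2 * c * dot (arc_der a t) v).
    move=> tI.
    have DX : is_derive t 1 X (dot (arc_der a t) v) by exact: arc_dot_derive.
    have DY : is_derive t 1 Y (dot (arc_der a t) m) by exact: arc_dot_derive.
    apply: is_derive_eq; rewrite /GRing.scale/= !fctE /=; ring.
  have lohi : arc_lo a <= arc_hi a by exact/ltW/arc_lt.
  have gmin t : t \in `]arc_lo a, arc_hi a[ -> g t0 <= g t.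
    move=> tI; rewrite !gE lerD2r t0p pE; apply: Bge.
    apply: boundary_sub; apply: (arc_in (P := body_boundary B)).
    exact: subset_itv_oo_cc.
  have D0 := derive1_at_min lohi (fun t tI => @ex_derive _ _ _ _ _ _ _ (gD t tI)) t0J gmin.
  have := @derive_val _ _ _ _ _ _ _ (gD t0 t0J); rewrite (@derive_val _ _ _ _ _ _ _ D0).
  move=> e; have {}e : 0 = 2 * y * dot d m + 2 * c * dot d v.
    by rewrite e /y dotBl -t0p.
  by rewrite dotDl !dotZl (dotC v) (dotC m); lra.
have nE : dot (c *: v + y *: m) (c *: v + y *: m) = c ^+ 2 + y ^+ 2.
  by rewrite !dotDl !dotDr !dotZl !dotZr (dotC m v) vm v1 m1; ring.
have n0 : c *: v + y *: m != 0 by rewrite -dot_gt0 nE; nra.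
have cy0 : c ^+ 2 + y ^+ 2 != 0 by rewrite gt_eqF//; nra.
have fpE : f - p = - x *: v + - y *: m.
  apply/eqP; rewrite -subr_eq0; apply/eqP; apply: (frame_eq0 fvm).
    by rewrite !dotE (dotC m v) v1 vm /x !dotE; ring.
  by rewrite !dotE vm m1 /y !dotE; ring.
have mE : mirror d v = (2 * c / (c ^+ 2 + y ^+ 2)) *: (f - p).
  rewrite (mirrorE v d0 n0 tangent) nE dotDr !dotZr v1 vm fpE.
  have xE : x = (c ^+ 2 - y ^+ 2) / (2 * c).
    have -> : c ^+ 2 - y ^+ 2 = x * (2 * c) by rewrite -pE; ring.
    by rewrite mulfK// mulf_neq0 ?pnatr_eq0// gt_eqF.
  rewrite xE; apply: pair_ext; rewrite !pairE /=; field; rewrite gt_eqF// cy0//.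
apply: (@single_reflection B v i t0) => //.
- apply/negP => /eqP vd.
  have dm : dot d m = 0.
    move: vd; case: mv => ->; rewrite ?dotNr; move: (dot_perpl v d) => /=.
      by rewrite dotC => -> ->; rewrite oppr0.
    by rewrite dotC => -> ->; rewrite !oppr0.
  move: tangent; rewrite dotDl !dotZl (dotC m) dm mulr0 addr0 => /eqP.
  rewrite mulf_eq0 gt_eqF//= => /eqP; rewrite dotC => dv.
  by move: d0; rewrite (frame_eq0 fvm dv dm) eqxx.
- by rewrite -/a t0p.
move=> s s0; rewrite -/a t0p -/d mE scalerA.
set k := s * _; have k0 : 0 < k.
  by rewrite /k mulr_gt0// divr_gt0 ?mulr_gt0//; nra.
have qE : p + k *: (f - p) - f = (1 - k) *: (p - f).
  by apply: pair_ext; rewrite !pairE /=; ring.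
move=> Bq; have := below _ Bq; have := Bge _ Bq.
rewrite qE !dotZl -/x -/y => h1 h2.
(* for [1 <= k] the point is not below the focus *)
have k1 : k < 1 by nra.
have : (1 - k) * (2 * c * x) = (1 - k) * (c ^+ 2 - y ^+ 2) by rewrite -pE; ring.
have h3 : 0 < k * c ^+ 2 by rewrite mulr_gt0// exprn_gt0.
have h4 : 0 <= k * (1 - k) * y ^+ 2.
  by rewrite mulr_ge0 ?sqr_ge0// mulr_ge0 ?subr_ge0// ltW.
by lra.
Qed.

(** * First touching points *)

(** The line through [p] of direction [v] supports [K] on the side of [m], and
    [p] is the first point of [K] on it. *)
Definition first_touch (K : set (R * R)) v m p : Prop :=
  [/\ K p, forall q, K q -> dot (q - p) m <= 0
    & forall q, K q -> dot (q - p) m = 0 -> 0 <= dot (q - p) v].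

Lemma first_touch_exists (K : set (R * R)) v m : compact K -> K !=set0 ->
  exists p, first_touch K v m p.
Proof.
move=> kK K0.
have cK : closed K by apply: compact_closed kK; exact: norm_hausdorff.
have cd (m' : R * R) A : {within A, continuous (fun q => dot q m')}.
  by apply: continuous_subspaceT => q; exact: continuous_dot.
have [q1 /set_mem Kq1 q1max] := compact_EVT_max K0 kK (cd m K).
pose L := K `&` [set q | dot q m = dot q1 m].
have kL : compact L.
  have sL : L `<=` K by move=> ? [].
  refine (subclosed_compact _ kK sL); apply: closedI => //.
  apply: (@closed_comp _ _ (fun q => dot q m) [set dot q1 m]).
    by move=> q _; exact: continuous_dot.
  exact: closed_eq.
have [p /set_mem[Kp pm] pmin] := compact_EVT_min (ex_intro _ q1 (conj Kq1 erefl)) kL (cd v L).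
exists p; split=> // q Kq; rewrite dotBl.
  by rewrite subr_le0 pm; apply: q1max; exact: mem_set.
move=> /eqP; rewrite subr_eq0 => /eqP qm; rewrite dotBl subr_ge0; apply: pmin.
by apply: mem_set; split=> //=; rewrite qm.
Qed.

(** Suppose a curve in the body leaves the first touching point [p] backwards.
    Put the focus at [f = p + r *: (k *: m - v)], slightly above and behind [p].
    The curve enters the parabola through [p], so [p] is not the contact point;
    and for small [r] the region that can contain the contact point is a thin
    strip behind [p] along the supporting line, which contains no other
    singular point since that half-line does not meet the body. The contact
    point is then regular, against [parabola_visible]. *)
Lemma germ_forward B v m p d (g : R -> R * R) :
  frame v m -> invisible B v -> first_touch (body_set B) v m p ->
  (\forall s \near 0^'+, body_set B (g s)) ->
  s^-1 *: (g s - p) @[s --> 0^'+] --> d ->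
  0 <= dot d v /\ dot d m <= 0.
Proof.
move=> fvm inv [Bp pm pv] Bg gd.
have vm := frame_orth fvm; have m1 := frame_unit fvm; have v1 := fvm.1.
have gdot (n : R * R) : s^-1 * dot (g s - p) n @[s --> 0^'+] --> dot d n.
  have : dot (s^-1 *: (g s - p)) n @[s --> 0^'+] --> dot d n.
    by apply: cvg_dot => //; exact: cvg_cst.
  by under eq_fun do rewrite dotZl.
have pos : \forall s \near 0^'+, 0 < s :> R by exact: nbhs_right_gt.
have dm : dot d m <= 0.
  apply: (cvgr_to_le (gdot m)); apply: filterS2 pos Bg => s s0 Bs.
  by rewrite pmulr_rle0 ?invr_gt0//; exact: pm.
split=> //; rewrite leNgt; apply/negP => dv.
set a := dot d v in dv; set b := dot d m in dm.
(* with this slope, the length of the path to [f] decreases along the germ *)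
pose k := - a / (1 - a - b).
have den : 0 < 1 - a - b by lra.
have k0 : 0 < k by rewrite divr_gt0// oppr_gt0.
have k1 : k < 1 by rewrite ltr_pdivrMr//; lra.
have kb : k * - b < - a.
  by rewrite /k mulrAC ltr_pdivrMr//; nra.
(* [far r q] keeps the contact point of the parabola away from [q] *)
pose far (r : R) q := dot (q - p) m < 0 -> r * (6 * - dot (q - p) v) < dot (q - p) m ^+ 2.
have nfar q : \forall r \near 0^'+, far r q.
  rewrite /far; have [Y0|Y0] := ltP (dot (q - p) m) 0; last first.
    by near=> r => ?.
  have c : r * (6 * - dot (q - p) v) @[r --> (0 : R)^'+] --> 0 * (6 * - dot (q - p) v).
    by apply: cvgM; [exact: cvg_at_right_filter|exact: cvg_cst].
  have Y2 : 0 * (6 * - dot (q - p) v) < dot (q - p) m ^+ 2 by nra.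
  by apply: filterS (cvgr_lt _ c _ Y2) => r ? _.
have [r [r0 rfar]] : exists r : R, 0 < r /\ forall q, singular_points (body_boundary B) q -> far r q.
  have nf : \forall r \near (0 : R)^'+, forall k : 'I_(ps_size (body_boundary B)) * bool,
      far r (end_point k).
    by apply: filter_forall => k'; exact: nfar.
  have [r [r0 h]] := filter_ex (filterI (nbhs_right_gt 0) nf).
  by exists r; split=> // q /singular_end[k' ->]; exact: h.
pose f := p + r *: (k *: m - v).
have fv q : dot (q - f) v = dot (q - p) v + r.
  by rewrite /f !dotE (dotC m) vm v1; ring.
have fm q : dot (q - f) m = dot (q - p) m - r * k.
  by rewrite /f !dotE vm m1; ring.
have rk : 0 < r * k by rewrite mulr_gt0.
have below q : body_set B q -> dot (q - f) m < 0.
  by move=> /pm; rewrite fm; lra.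
have [c [z [c0 Bz zE Bge]]] := parabola_contact v (@body_compact _ B) (ex_intro _ p Bp) below.
apply: (parabola_visible fvm below c0 Bz zE Bge) inv => zs.
have pge := Bge p Bp.
rewrite fm fv subrr /dot/= !mul0r addr0 in pge.
have {}pge : c ^+ 2 <= r ^+ 2 * k ^+ 2 + 2 * c * r by nra.
have c3 : c <= 3 * r.
  have k2 : k ^+ 2 < 1 by rewrite expr2; nra.
  have : r ^+ 2 * k ^+ 2 <= r ^+ 2 by rewrite ler_piMr ?sqr_ge0// ltW.
  nra.
(* if [p] were the contact point, the germ, to first order, would enter the
   parabola *)
have zp : z != p.
  apply/eqP => zp; rewrite zp fm fv subrr /dot/= !mul0r addr0 in zE.
  have {}zE : c ^+ 2 = r ^+ 2 * k ^+ 2 + 2 * c * r by rewrite -zE; ring.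
  have c2r : 2 * r <= c.
    rewrite -(ler_pM2l c0); have : 0 <= r ^+ 2 * k ^+ 2 by rewrite mulr_ge0 ?sqr_ge0.
    lra.
  have lim : s * (s^-1 * dot (g s - p) m) ^+ 2 - 2 * (r * k) * (s^-1 * dot (g s - p) m)
      + 2 * c * (s^-1 * dot (g s - p) v) @[s --> (0 : R)^'+] -->
      0 * b ^+ 2 - 2 * (r * k) * b + 2 * c * a.
    apply: cvgD; last by apply: cvgM; [exact: cvg_cst|exact: gdot].
    apply: cvgB; last by apply: cvgM; [exact: cvg_cst|exact: gdot].
    apply: cvgM; first exact: cvg_at_right_filter.
    by rewrite !expr2; under eq_fun do rewrite expr2; apply: cvgM; exact: gdot.
  have : 0 <= 0 * b ^+ 2 - 2 * (r * k) * b + 2 * c * a.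
    apply: (cvgr_to_ge lim); apply: filterS2 pos Bg => s s0 /Bge.
    rewrite fm fv zE => h.
    rewrite -(pmulr_rge0 _ s0).
    have ss : s * s^-1 = 1 by rewrite mulfV// gt_eqF.
    move: h; set Y := dot _ m; set X := dot _ v => h.
    have -> : s * (s * (s^-1 * Y) ^+ 2 - 2 * (r * k) * (s^-1 * Y) + 2 * c * (s^-1 * X)) =
      (s * s^-1 * Y) ^+ 2 - 2 * (r * k) * (s * s^-1 * Y) + 2 * c * (s * s^-1 * X) by ring.
    by rewrite ss !mul1r; lra.
  have ca : c * a <= 2 * r * a by rewrite ler_wnM2r// ltW.
  have : r * (k * - b) < r * - a by rewrite ltr_pM2l.
  have : r * a < 0 by rewrite pmulr_rlt0.
  lra.
have := rfar z zs; rewrite /far; have := pm z Bz; have := pv z Bz; rewrite fm fv in zE.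
move: zE; set X := dot (z - p) v; set Y := dot (z - p) m => zE hX Y0 hfar.
have e1 : Y ^+ 2 + 2 * c * X <= 0 by nra.
have [X0|X0] := ltP X 0; last first.
  have Yz : Y = 0 by nra.
  have Xz : X = 0 by nra.
  by move: zp; rewrite -subr_eq0 (frame_eq0 fvm Xz Yz) eqxx.
have Ylt : Y < 0.
  by rewrite lt_neqAle Y0 andbT; apply/eqP => /hX; lra.
have cX : 3 * r * X <= c * X by rewrite ler_wnM2r// ltW.
by have := hfar Ylt; lra.
Unshelve. all: by end_near. Qed.

Lemma first_touch_boundary B v m p : frame v m ->
  first_touch (body_set B) v m p -> boundary (body_set B) p.
Proof.
move=> vm [Bp pm _]; apply: (@boundary_exit _ _ m) => // s s0 /pm.
by rewrite addrC addKr dotZl (frame_unit vm) mulr1 leNgt s0.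
Qed.

Lemma cvg_affine_right t (e : R) : t + e * s @[s --> (0 : R)^'+] --> t.
Proof.
rewrite -[X in _ --> X]addr0 -[X in _ + X](mulr0 e); apply: cvgD; first exact: cvg_cst.
by apply: cvgM; [exact: cvg_cst|exact: cvg_at_right_filter].
Qed.

(** The sign [e] covers the right and the left germ of an arc at once. *)
Lemma arc_germ (c : Defs.arc R) t (e : R) : t \in `[arc_lo c, arc_hi c] ->
  e ^+ 2 = 1 ->
  (\forall s \near 0^'+, t + e * s \in `[arc_lo c, arc_hi c]) ->
  s^-1 *: (arc_fun c (t + e * s) - arc_fun c t) @[s --> 0^'+] --> e *: arc_der c t.
Proof.
move=> tI e2 itv.
have e0 : e != 0 by apply: contra_eq_neq e2 => ->; rewrite expr0n eq_sym oner_neq0.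
have ch := @cvg_affine_right t e.
have h : (t + e * s - t)^-1 *: (arc_fun c (t + e * s) - arc_fun c t) @[s --> (0 : R)^'+]
    --> arc_der c t.
  move=> U nU; have nn : \forall s \near t, s != t -> s \in `[arc_lo c, arc_hi c] ->
    U ((s - t)^-1 *: (arc_fun c s - arc_fun c t)) by exact: (arc_derE tI nU).
  suff : \forall s \near (0 : R)^'+,
    U ((t + e * s - t)^-1 *: (arc_fun c (t + e * s) - arc_fun c t)) by [].
  have n0 : \forall s \near (0 : R)^'+, 0 < s by exact: nbhs_right_gt.
  apply: filterS3 n0 itv (ch _ nn) => s s0 sI; apply => //.
  by rewrite -subr_eq0 addrAC subrr add0r mulf_neq0// gt_eqF.
have h' : e *: ((t + e * s - t)^-1 *: (arc_fun c (t + e * s) - arc_fun c t))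
    @[s --> (0 : R)^'+] --> e *: arc_der c t.
  by apply: cvgZ => //; exact: cvg_cst.
refine (cvg_near_eq h' _); near=> s.
rewrite scalerA addrAC subrr add0r invfM mulrA mulfV// mul1r//.
Unshelve. all: by end_near. Qed.

(** An arc that runs through [p] in its interior has two opposite germs there;
    both are forward and below the supporting line, so the tangent would
    vanish. *)
Lemma first_touch_end B v m p i t : frame v m -> invisible B v ->
  first_touch (body_set B) v m p ->
  let c := ps_arc (body_boundary B) i in
  t \in `[arc_lo c, arc_hi c] -> arc_fun c t = p ->
  (t = arc_lo c /\ 0 <= dot (arc_der c t) v) \/
  (t = arc_hi c /\ dot (arc_der c t) v <= 0).
Proof.
move=> fvm inv ft c tI tp.
have lohi : arc_lo c < arc_hi c := arc_lt c.
have germ (e : R) : e ^+ 2 = 1 ->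
    (\forall s \near 0^'+, t + e * s \in `[arc_lo c, arc_hi c]) ->
    0 <= e * dot (arc_der c t) v /\ e * dot (arc_der c t) m <= 0.
  move=> e2 itv; rewrite -!dotZl.
  apply: (germ_forward fvm inv ft (g := fun s => arc_fun c (t + e * s))).
    apply: filterS itv => s sI; apply: boundary_sub.
    exact: (arc_in (P := body_boundary B)).
  by rewrite -tp; apply: arc_germ.
have pos : \forall s \near (0 : R)^'+, 0 < s by exact: nbhs_right_gt.
have right : t < arc_hi c -> 0 <= dot (arc_der c t) v /\ dot (arc_der c t) m <= 0.
  move=> th; have := germ 1 (expr1n _ _); rewrite !mul1r; apply.
  apply: filterS2 pos (cvgr_lt _ (@cvg_affine_right t 1) _ th) => s s0 sh.
  by move: tI; rewrite !in_itv/= mul1r in sh *; lra.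
have left : arc_lo c < t -> dot (arc_der c t) v <= 0 /\ 0 <= dot (arc_der c t) m.
  move=> tl; have e2 : (- 1) ^+ 2 = 1 :> R by rewrite sqrrN expr1n.
  have := germ (- 1) e2.
  rewrite !mulN1r oppr_ge0 oppr_le0; apply.
  apply: filterS2 pos (cvgr_gt _ (@cvg_affine_right t (-1)) _ tl) => s s0 sh.
  by move: tI; rewrite !in_itv/= mulN1r in sh *; lra.
have [tl|tl|t_in] := itvcc_cases tI.
- by left; split=> //; apply: (right _).1; rewrite tl.
- by right; split=> //; apply: (left _).1; rewrite tl.
exfalso; move: t_in; rewrite in_itv/= => /andP[tl th].
have [v1' m1'] := left tl; have [v2 m2] := right th.
have /negP := arc_der_neq0 tI; apply; apply/eqP/(frame_eq0 fvm); apply/eqP.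
  by rewrite eq_le v1' v2.
by rewrite eq_le m1' m2.
Qed.

(** Unless [v] is perpendicular to an end tangent, the arcs at the first touching
    point leave it strictly forward. For [- v] the same holds at the first
    touching point from the other side, where they leave strictly backward.
    The two points are therefore distinct arc ends on a line of direction
    [v]. *)
Lemma invisible_exceptional B v (P := body_boundary B) :
  unit_circle R v -> invisible B v ->
  (exists k : 'I_(ps_size P) * bool, dot v (arc_der (ps_arc P k.1) (arc_end k)) = 0) \/
  (exists k l : 'I_(ps_size P) * bool, end_point k != end_point l /\
    dot v (perp (end_point k - end_point l)) = 0).
Proof.
move=> v1 inv.
have [[k kv]|nperp] := pselect (exists k : 'I_(ps_size P) * bool,
    dot v (arc_der (ps_arc P k.1) (arc_end k)) = 0); first by left; exists k.
right.
have K0 : body_set B !=set0.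
  exists (end_point (P := P) (Ordinal (ps_size_gt0 P), true)).
  by apply: boundary_sub; apply: (arc_in (P := P)); exact: arc_end_in.
have [p fp] := first_touch_exists v (perp v) (@body_compact _ B) K0.
have [q fq] := first_touch_exists (- v) (perp v) (@body_compact _ B) K0.
have fv := frame_perp v1; have fv' := frame_opp fv.
have inv' := invisible_opp v1 inv.
have nz i (e : bool) : dot (arc_der (ps_arc P i) (arc_end (P := P) (i, e))) v != 0.
  by apply/eqP => h; apply: nperp; exists (i, e); rewrite dotC.
have endp i t : t \in `[arc_lo (ps_arc P i), arc_hi (ps_arc P i)] ->
    arc_fun (ps_arc P i) t = p ->
  (t = arc_lo (ps_arc P i) /\ 0 < dot (arc_der (ps_arc P i) t) v) \/
  (t = arc_hi (ps_arc P i) /\ dot (arc_der (ps_arc P i) t) v < 0).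
  move=> tI tp.
  have [[tE h]|[tE h]] := first_touch_end fv inv fp tI tp; [left|right]; split=> //.
    by rewrite lt_neqAle h eq_sym andbT tE; exact: (nz i true).
  by rewrite lt_neqAle h andbT tE; exact: (nz i false).
have [i [t [tI tp]]] := arc_cover P (first_touch_boundary fv fp).
have [j [s [sI sq]]] := arc_cover P (first_touch_boundary fv' fq).
have [k kp] : exists k : 'I_(ps_size P) * bool, end_point k = p.
  by have [[tE _]|[tE _]] := endp i t tI tp;
    [exists (i, true)|exists (i, false)]; rewrite /end_point /arc_end /= -tE.
have [l lq] : exists l : 'I_(ps_size P) * bool, end_point l = q.
  by have [[sE _]|[sE _]] := first_touch_end fv' inv' fq sI sq;
    [exists (j, true)|exists (j, false)]; rewrite /end_point /arc_end /= -sE.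
exists k, l; rewrite kp lq; split.
  apply/eqP => pq; move: sq; rewrite -pq => sp.
  have lohi : arc_lo (ps_arc P j) < arc_hi (ps_arc P j) := arc_lt _.
  have := first_touch_end fv' inv' fq sI; rewrite -pq => /(_ sp).
  rewrite dotNr -/P => -[[sE h]|[sE h]]; have [[sE' h']|[sE' h']] := endp j s sI sp.
  - by move: h'; rewrite ltNge -oppr_ge0 h.
  - by move: lohi; rewrite -sE -sE' ltxx.
  - by move: lohi; rewrite -sE -sE' ltxx.
  - by move: h'; rewrite ltNge -oppr_le0 h.
have [_ pm _] := fp; have [_ qm _] := fq.
have [Bp _ _] := fp; have [Bq _ _] := fq.
have pq : dot (p - q) (perp v) = 0.
  apply/eqP; rewrite eq_le qm//= -oppr_le0 -dotNl opprB; exact: pm.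
by rewrite dotC dot_perpl pq oppr0.
Qed.

End Invisibility.

Theorem theorem1 (R : realType) (B : body R) :
  finite_set [set v | unit_circle R v /\ invisible B v].
Proof.
pose P := body_boundary B; pose K := ('I_(ps_size P) * bool)%type.
pose E1 := \bigcup_(k in [set: K])
  [set v | unit_circle R v /\ dot v (arc_der (ps_arc P k.1) (arc_end k)) = 0].
pose E2 := \bigcup_(kl in [set kl : K * K | end_point kl.1 != end_point kl.2])
  [set v | unit_circle R v /\ dot v (perp (end_point kl.1 - end_point kl.2)) = 0].
apply: (@sub_finite_set _ _ (E1 `|` E2)).
  move=> v [v1 inv]; have [[k kv]|[k [l [kl klv]]]] := invisible_exceptional v1 inv.
    by left; exists k.
  by right; exists (k, l).
rewrite finite_setU; split; apply: bigcup_finite; try exact: finite_finset.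
  by move=> k _; apply/unit_orth_finite/arc_der_neq0/arc_end_in.
move=> [k l] /= kl; apply: unit_orth_finite.
by rewrite -dot_gt0 dot_perp_perp dot_gt0 subr_eq0.
Qed.
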